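(* Let $X=\{X_t\}_{t\ge0}$ be a Markov chain with finite state space $S$ and stationary distribution $\pi$. Then, for any $y\in S$ and any integer $t>0$, $$\mathbf{P}_\pi(\tau(y)=t)\le\frac1t.$$ In particular, for any state $x\in S$, $$\mathbf{P}_x(\tau(y)=t)\le\frac{1}{t\,\pi(x)}.$$
   Context: Markov chains are in discrete time and time-homogeneous. $\mathbf{P}_x$ denotes the probability for the chain started at $X_0=x$, and $\mathbf{P}_\pi$ the probability for the chain started from a random state $X_0$ sampled from $\pi$. The hitting time is $\tau(y)=\min\{t\ge 0: X_t=y\}$ ($\infty$ if $y$ is never reached). If $\pi(x)=0$ the right-hand side of the last bound is read as $+\infty$. *)

(* Defs.v *)
From HB Require Import structures.
From mathcomp Require Import all_boot all_order all_algebra.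
From mathcomp Require Import all_classical all_reals all_analysis.

Set Implicit Arguments.
Unset Strict Implicit.
Unset Printing Implicit Defensive.

Import Order.TTheory GRing.Theory Num.Theory.
Local Open Scope classical_set_scope.
Local Open Scope ring_scope.

Section finite_distributions.
Context {R : realType} {S : finType}.

Definition is_distribution (mu : S -> R) : Prop :=
  (forall x, 0 <= mu x) /\ \sum_x mu x = 1.

Definition is_transition_matrix (p : S -> S -> R) : Prop :=
  forall x, is_distribution (p x).

Definition is_stationary (p : S -> S -> R) (pi : S -> R) : Prop :=
  is_distribution pi /\ forall y, \sum_x pi x * p x y = pi y.

Definition point_mass (x : S) : S -> R := fun z => (z == x)%:R.

End finite_distributions.

Section markov_chains.
Context {R : realType} {S : finType} {d : measure_display}
  {T : measurableType d}.

Definition cond_prob (P : probability T R) (A B : set T) : \bar R :=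
  (P (A `&` B) / P B)%E.

(* [X] is a time-homogeneous Markov chain with transition matrix [p] and
   X_0 distributed according to [mu].  [S] carries the discrete sigma-algebra;
   conditional probabilities are constrained only given past trajectories of
   positive probability (only the values [h 0], ..., [h t] matter). *)
Definition is_markov_chain (P : probability T R) (p : S -> S -> R)
    (mu : S -> R) (X : nat -> T -> S) : Prop :=
  [/\ forall (t : nat) (A : set S), measurable (X t @^-1` A),
      forall x : S, P [set w | X 0%N w = x] = (mu x)%:E &
      forall (t : nat) (h : nat -> S) (y : S),
        let past := [set w | forall s, (s <= t)%N -> X s w = h s] in
        P past != 0%E ->
        cond_prob P [set w | X t.+1 w = y] past = (p (h t) y)%:E].

(* [None] stands for infinity. *)
Definition hitting_time (X : nat -> T -> S) (y : S) (w : T) : option nat :=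
  match pselect (exists t : nat, X t w == y) with
  | left hit => Some (ex_minn hit)
  | right _ => None
  end.

End markov_chains.

(* Main.v *)
(* Under the stationary distribution pi, the probability of the event
   {X_0, ..., X_(t-1) <> y, X_t = y} is nonincreasing in t: forgetting the
   condition X_0 <> y in {tau(y) = t + 1} leaves, by stationarity, an event of
   probability P_pi(tau(y) = t).  The events {tau(y) = s}, s < t, being
   disjoint, t * P_pi(tau(y) = t) is at most the sum of their probabilities,
   hence at most 1. *)
Require Import Defs.
From mathcomp Require Import all_boot all_order all_algebra.
From mathcomp Require Import all_classical all_reals all_analysis.

Import Order.TTheory GRing.Theory Num.Theory.

Local Open Scope classical_set_scope.
Local Open Scope ring_scope.

Section first_hit_probability.
Context {R : realType} {S : finType} (p : S -> S -> R) (y : S).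

(* [first_hit_prob t z] is P_z(tau(y) = t). *)
Fixpoint first_hit_prob (t : nat) (z : S) : R :=
  if t is s.+1 then if z == y then 0 else \sum_w p z w * first_hit_prob s w
  else (z == y)%:R.

Hypothesis hp : is_transition_matrix p.

Lemma first_hit_prob_ge0 t z : 0 <= first_hit_prob t z.
Proof.
elim: t z => [|t IH] z /=; first exact: ler0n.
case: ifP => // _; apply: sumr_ge0 => w _.
by rewrite mulr_ge0 //; case: (hp z).
Qed.

(** First-step analysis: from [y] only the term [t = 0] survives; from any other state that term
    vanishes and the rest is a [p z]-average of shorter sums. *)
Lemma sum_first_hit_prob_le1 n z : \sum_(t < n) first_hit_prob t z <= 1.
Proof.
elim: n z => [|n IH] z; first by rewrite big_ord0.
rewrite big_ord_recl; under eq_bigr do rewrite lift0.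
rewrite /=; case: eqP => _; first by rewrite big1 ?addr0.
rewrite add0r exchange_big /=; have [p_ge0 <-] := hp z.
by apply: ler_sum => w _; rewrite -mulr_sumr ler_piMr.
Qed.

Context (pi : S -> R).
Hypothesis hpi : is_stationary p pi.

Lemma stationary_first_hit_prob_anti :
  {homo (fun t => \sum_z pi z * first_hit_prob t z) : s t / (s <= t)%N >-> t <= s}.
Proof.
have [[pi_ge0 _] pi_p] := hpi.
apply: (homo_leq (r := fun a b : R => b <= a)) => [//|b a c ab bc|t].
  exact: le_trans bc ab.
(* Stationarity inserts one step of the chain before time [t]; the two sides then differ only at
   [z = y], where the left-hand term is 0. *)
under [leRHS]eq_bigr do rewrite -pi_p mulr_suml.
rewrite exchange_big /=; apply: ler_sum => z _.
under [leRHS]eq_bigr do rewrite -mulrA.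
rewrite -mulr_sumr ler_wpM2l //; case: ifP => // _.
apply: sumr_ge0 => w _.
by rewrite mulr_ge0 ?first_hit_prob_ge0 //; case: (hp z).
Qed.

Lemma stationary_first_hit_prob_le t : (0 < t)%N ->
  \sum_z pi z * first_hit_prob t z <= t%:R^-1.
Proof.
move=> t_gt0; have [[pi_ge0 pi1] _] := hpi.
rewrite -[leRHS]mul1r ler_pdivlMr ?ltr0n //.
(* The factor [t] becomes a sum of [t] equal terms, each bounded by the term of an earlier time
   [s]. *)
rewrite mulr_natr -[X in _ *+ X]card_ord -sumr_const.
apply: (@le_trans _ _ (\sum_(s < t) \sum_z pi z * first_hit_prob s z)).
  by apply: ler_sum => s _; apply: stationary_first_hit_prob_anti; apply: ltnW.
rewrite -pi1 exchange_big /=; apply: ler_sum => z _.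
by rewrite -mulr_sumr ler_piMr ?sum_first_hit_prob_le1.
Qed.

End first_hit_probability.

Lemma measure_total_fin {d : measure_display} {T : measurableType d}
    {R : realType} (P : {measure set T -> \bar R}) {S : finType} (f : T -> S)
    (A : set T) :
  (forall B : set S, measurable (f @^-1` B)) -> measurable A ->
  P A = (\sum_z P (A `&` f @^-1` [set z]))%E.
Proof.
move=> mf mA.
have {1}-> : A = \bigcup_(z in [set: S]) (A `&` f @^-1` [set z]).
  by apply/seteqP; split=> [w Aw|w [z _ []]//]; exists (f w).
rewrite measure_fin_bigcup //; last 3 first.
- exact: finite_finset.
- by move=> u v _ _ [w [[_ <-] [_ <-]]].
- by move=> z _; apply: measurableI.
rewrite (fsbigE (index_enum S)) ?index_enum_uniq //.
- by apply: eq_bigl => z; rewrite in_setT.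
- by move=> z _; rewrite mem_index_enum.
Qed.

Section markov_first_hit.
Context {R : realType} {S : finType} {d : measure_display}
  {T : measurableType d} {P : probability T R} {p : S -> S -> R}
  {mu : S -> R} {X : nat -> T -> S}.
Hypothesis hp : is_transition_matrix p.
Hypothesis hX : is_markov_chain P p mu X.

Let past (t : nat) (h : nat -> S) : set T :=
  [set w | forall s, (s <= t)%N -> X s w = h s].

(** The clock starts at an arbitrary time [t], so that an induction on [k] can move the starting
    time forward. *)
Let first_hit_at (y : S) (t k : nat) : set T :=
  [set w | (forall j, (j < k)%N -> X (t + j)%N w <> y) /\ X (t + k)%N w = y].

Lemma measurable_past t h : measurable (past t h).
Proof.
have [mX _ _] := hX.
suff -> : past t h = \bigcap_(s in [set s | (s <= t)%N]) X s @^-1` [set h s].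
  by apply: bigcap_measurableType => s _; exact: mX.
by [].
Qed.

Lemma measurable_first_hit_at y t k : measurable (first_hit_at y t k).
Proof.
have [mX _ _] := hX.
have -> : first_hit_at y t k =
    (\bigcap_(j in [set j | (j < k)%N]) X (t + j)%N @^-1` ~` [set y]) `&`
    X (t + k)%N @^-1` [set y].
  by [].
apply: measurableI; last exact: mX.
by apply: bigcap_measurableType => j _; exact: mX.
Qed.

(** The Markov property in product form, which also covers pasts of probability zero: both sides
    then vanish. *)
Lemma prob_past_next t h z :
  P (past t h `&` X t.+1 @^-1` [set z]) = (P (past t h) * (p (h t) z)%:E)%E.
Proof.
have [mX _ /(_ t h z) /= step] := hX.
have mA := measurable_past t h; have mB := mX t.+1 [set z].
have fin_past : P (past t h) \is a fin_num by rewrite fin_num_measure.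
have [P0|Pn0] := eqVneq (P (past t h)) 0%E.
  by rewrite P0 mul0e; apply: (subset_measure0 _ _ _ P0) => //; apply: measurableI.
have := step Pn0; rewrite /cond_prob => <-.
by rewrite muleCA divee ?mule1 // setIC.
Qed.

(** Extends the one-step Markov property to the whole wait for [y], by induction on [k] for all [t]
    and [h]: condition on the value of [X t.+1] and absorb it into the past. *)
Lemma prob_past_first_hit y k t h :
  P (past t h `&` first_hit_at y t k) =
  (P (past t h) * (first_hit_prob p y k (h t))%:E)%E.
Proof.
elim: k t h => [|k IH] t h /=.
  case: eqP => [hy|hy].
    rewrite mule1; congr (P _); apply/seteqP; split=> [w []//|w pw].
    by split=> //; split=> //; rewrite addn0 pw.
  rewrite mule0 -[RHS](measure0 P); congr (P _); apply/seteqP; split=> // w.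
  by case=> pw [_]; rewrite addn0 pw.
case: eqP => [hy|hy].
  rewrite mule0 -[RHS](measure0 P); congr (P _); apply/seteqP; split=> // w.
  by case=> pw [/(_ 0%N isT)]; rewrite addn0 pw.
have [mX _ _] := hX.
rewrite (measure_total_fin P (X t.+1)) //; last first.
  by apply: measurableI; [exact: measurable_past | exact: measurable_first_hit_at].
rewrite -sumEFin ge0_sume_distrr => [|z _]; last first.
  by rewrite lee_fin mulr_ge0 ?first_hit_prob_ge0 //; case: (hp (h t)).
apply: eq_bigr => z _; rewrite EFinM muleA -prob_past_next.
(* The trajectory [h] prolonged by [z] at time [t.+1]. *)
pose hz s := if (s <= t)%N then h s else z.
have hzt : hz t.+1 = z by rewrite /hz ltnn.
have past_hz : past t.+1 hz = past t h `&` X t.+1 @^-1` [set z].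
  apply/seteqP; split=> w /=.
    move=> pw; split=> [s st|]; last by rewrite pw ?hzt.
    by rewrite pw ?(leqW st) // /hz st.
  case=> pw Xw s; rewrite leq_eqVlt => /predU1P[->|]; first by rewrite hzt.
  by rewrite ltnS /hz => st; rewrite st pw.
rewrite -past_hz -[in RHS]hzt -IH; congr (P _); rewrite past_hz.
(* As [h t <> y], the past already excludes a visit at time [t]; a wait of [k.+1] from [t] is thus a
   wait of [k] from [t.+1]. *)
apply/seteqP; split=> w /=.
  case=> -[pw [Hlt Hk]] Xw; split=> //; split; last by rewrite addSnnS.
  by move=> j jk; rewrite addSnnS; apply: Hlt.
case=> -[pw Xw] [Hlt Hk]; split=> //; split=> //.
split; last by rewrite -addSnnS.
case=> [|j]; first by rewrite addn0 pw.
by rewrite ltnS -addSnnS; apply: Hlt.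
Qed.

Lemma hitting_time_eq_Some y t :
  [set w | hitting_time X y w = Some t] = first_hit_at y 0 t.
Proof.
apply/seteqP; split=> w /=; rewrite /hitting_time; case: pselect => // hit.
- case: ex_minnP => m /eqP Xm min_m [<-]; split=> // j jm Xj.
  by have := min_m j; rewrite Xj eqxx leqNgt jm => /(_ isT).
- case: ex_minnP => m /eqP Xm min_m [Hlt Ht]; congr Some; apply/eqP.
  rewrite eqn_leq min_m ?Ht // leqNgt; apply/negP => mt.
  exact: Hlt Xm.
- by case=> _ Xt; case: hit; exists t; rewrite Xt.
Qed.

Lemma prob_hitting_time y t :
  P [set w | hitting_time X y w = Some t] =
  (\sum_z mu z * first_hit_prob p y t z)%:E.
Proof.
have [mX X0 _] := hX; rewrite hitting_time_eq_Some.
rewrite (measure_total_fin P (X 0%N)) //; last exact: measurable_first_hit_at.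
rewrite -sumEFin; apply: eq_bigr => z _; rewrite EFinM -X0 setIC.
(* A past up to time 0 constrains only [X 0], so a constant trajectory serves. *)
have past0 : past 0 (fun=> z) = [set w | X 0%N w = z].
  apply/seteqP; split=> w /=; first by apply.
  by move=> Xw s; rewrite leqn0 => /eqP ->.
by rewrite -past0 -prob_past_first_hit past0.
Qed.

End markov_first_hit.

(* In the extended reals 0^-1 is +oo, so the last bound is +oo if pi x = 0. *)
Theorem proposition1p7 (R : realType) (S : finType)
    (p : S -> S -> R) (pi : S -> R)
    (hp : is_transition_matrix p) (hpi : is_stationary p pi) :
  (forall (d : measure_display) (T : measurableType d) (P : probability T R)
      (X : nat -> T -> S), is_markov_chain P p pi X ->
    forall (y : S) (t : nat), (0 < t)%N ->
      (P [set w | hitting_time X y w = Some t] <= (t%:R^-1)%:E)%E) /\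
  (forall (x : S) (d : measure_display) (T : measurableType d)
      (P : probability T R) (X : nat -> T -> S),
    is_markov_chain P p (point_mass x) X ->
    forall (y : S) (t : nat), (0 < t)%N ->
      (P [set w | hitting_time X y w = Some t] <= ((t%:R * pi x)%:E)^-1)%E).
Proof.
split=> [d T P X hX y t t_gt0|x d T P X hX y t t_gt0];
  rewrite (prob_hitting_time hp hX).
  by rewrite lee_fin stationary_first_hit_prob_le.
under eq_bigr do rewrite /point_mass mulr_natl mulrb.
rewrite -big_mkcond big_pred1_eq inver mulf_eq0 pnatr_eq0 gtn_eqF //=.
case: eqP => [_|/eqP pix_neq0]; first exact: leey.
have [[pi_ge0 _] _] := hpi.
have pix_gt0 : 0 < pi x by rewrite lt0r pix_neq0 pi_ge0.
rewrite lee_fin invfM ler_pdivlMr // mulrC.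
(* The left-hand side is the [x] term of the stationary sum, whose other terms are nonnegative. *)
apply: le_trans (stationary_first_hit_prob_le p y hp pi hpi t t_gt0).
rewrite (bigD1 x) //= lerDl sumr_ge0 // => z _.
by rewrite mulr_ge0 ?first_hit_prob_ge0.
Qed.
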